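(* Let $N\ge 1$ and let $\rho=\sum_{n=0}^N\chi_n\,|D_{N,n}\rangle\langle D_{N,n}|$ be a general diagonal symmetric (GDS) state of $N$ qubits. Put $m_0:=\lfloor N/2\rfloor$ and $m_1:=\lfloor (N+1)/2\rfloor$. Then $\rho$ is separable if and only if the two real Hankel matrices $$M_0:=(\chi_{i+j})_{0\le i,j\le m_0}=\begin{pmatrix}\chi_0&\chi_1&\cdots&\chi_{m_0}\\ \chi_1&\chi_2&\cdots&\chi_{m_0+1}\\ \vdots&\vdots&&\vdots\\ \chi_{m_0}&\chi_{m_0+1}&\cdots&\chi_{2m_0}\end{pmatrix},\qquad M_1:=(\chi_{i+j-1})_{1\le i,j\le m_1}=\begin{pmatrix}\chi_1&\chi_2&\cdots&\chi_{m_1}\\ \chi_2&\chi_3&\cdots&\chi_{m_1+1}\\ \vdots&\vdots&&\vdots\\ \chi_{m_1}&\chi_{m_1+1}&\cdots&\chi_{2m_1-1}\end{pmatrix}$$ are both positive semidefinite.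
   Context: Let $|0\rangle,|1\rangle$ be the standard orthonormal basis of $\mathbb{C}^2$. For $0\le n\le N$ the unnormalized $N$-qubit Dicke state is the vector $|D_{N,n}\rangle\in(\mathbb{C}^2)^{\otimes N}$ equal to the sum of all $\binom{N}{n}$ distinct standard basis vectors $|x_1\rangle\otimes\cdots\otimes|x_N\rangle$ with $x\in\{0,1\}^N$ having exactly $n$ entries equal to $0$ (and $N-n$ entries equal to $1$); equivalently, $(|1\rangle+z|0\rangle)^{\otimes N}=\sum_{n=0}^N z^n|D_{N,n}\rangle$ for all $z\in\mathbb{C}$. A quantum state is a positive semidefinite operator of trace one. A general diagonal symmetric (GDS) state is a quantum state of the form $\rho=\sum_{n=0}^N\chi_n|D_{N,n}\rangle\langle D_{N,n}|$ (so $\chi_n\ge 0$ for all $n$). A state on $(\mathbb{C}^2)^{\otimes N}$ is separable if it is a finite convex combination of product states $\alpha_1\otimes\cdots\otimes\alpha_N$, each $\alpha_k$ being a state on $\mathbb{C}^2$. *)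

(* Defs.v *)
From HB Require Import structures.
From mathcomp Require Import all_boot all_order all_algebra.
From mathcomp Require Import complex reals.

Set Implicit Arguments.
Unset Strict Implicit.
Unset Printing Implicit Defensive.

Import Order.TTheory GRing.Theory Num.Theory.
Local Open Scope ring_scope.
Local Open Scope sesquilinear_scope.

Notation bits N := {ffun 'I_N -> 'I_2}.
Notation dimq N := #|{ffun 'I_N -> 'I_2}|.

(* The standard basis of the N-qubit space is indexed by strings in {0,1}^N;
   [bits_of] is the string carried by a row or column index. *)
Definition bits_of (N : nat) (i : 'I_(dimq N)) : bits N := enum_val i.

Definition tensor_vec (C : comNzRingType) (N : nat) (v : 'I_N -> 'cV[C]_2) :
    'cV[C]_(dimq N) :=
  \col_i \prod_(k < N) v k (bits_of i k) 0.

Definition tensor_op (C : comNzRingType) (N : nat) (A : 'I_N -> 'M[C]_2) :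
    'M[C]_(dimq N) :=
  \matrix_(i, j) \prod_(k < N) A k (bits_of i k) (bits_of j k).

Definition ket (C : comNzRingType) (a : 'I_2) : 'cV[C]_2 := delta_mx a 0.

(* Excitations are the 0s, not the 1s as in the more common convention. *)
Definition dicke (C : comNzRingType) (N n : nat) : 'cV[C]_(dimq N) :=
  \sum_(x : bits N | #|[set k | x k == 0]| == n)
     tensor_vec (fun k => ket C (x k)).

Definition psdmx (C : numClosedFieldType) (d : nat) (A : 'M[C]_d) : Prop :=
  A ^t* = A /\ forall v : 'cV[C]_d, 0 <= (v ^t* *m A *m v) 0 0.

Definition real_psdmx (R : realType) (d : nat) (A : 'M[R]_d) : Prop :=
  A^T = A /\ forall v : 'cV[R]_d, 0 <= (v^T *m A *m v) 0 0.

Definition is_state (C : numClosedFieldType) (d : nat) (A : 'M[C]_d) : Prop :=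
  psdmx A /\ \tr A = 1.

Definition diag_sym (R : realType) (N : nat) (chi : nat -> R) :
    'M[R[i]]_(dimq N) :=
  \sum_(n < N.+1)
     (chi n)%:C%C *: (dicke R[i] N n *m (dicke R[i] N n) ^t*).

Definition separable (R : realType) (N : nat) (rho : 'M[R[i]]_(dimq N)) : Prop :=
  exists (s : nat) (p : 'I_s -> R) (alpha : 'I_s -> 'I_N -> 'M[R[i]]_2),
    [/\ forall l, 0 <= p l,
        \sum_(l < s) p l = 1,
        forall l k, is_state (alpha l k) &
        rho = \sum_(l < s) (p l)%:C%C *: tensor_op (alpha l)].

Definition hankel0 (R : realType) (N : nat) (chi : nat -> R) :
    'M[R]_(N./2.+1) :=
  \matrix_(i, j) chi (i + j)%N.

(* The 1-based entry χ_(i+j-1), 1 <= i, j <= ⌊(N+1)/2⌋, in 0-based indices. *)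
Definition hankel1 (R : realType) (N : nat) (chi : nat -> R) :
    'M[R]_(N.+1./2) :=
  \matrix_(i, j) chi (i + j).+1.

Lemma tensor_ketE (C : comNzRingType) (N : nat) (x : bits N) i :
  tensor_vec (fun k => ket C (x k)) i 0 = (bits_of i == x)%:R.
Proof.
rewrite mxE; have [->|neq] := eqVneq.
  by rewrite big1 // => k _; rewrite mxE !eqxx.
have [k xk] : exists k, bits_of i k != x k.
  apply/existsP; apply: contraNT neq; rewrite negb_exists => /forallP h.
  by apply/eqP/ffunP => k; apply/eqP; move: (h k); rewrite negbK.
by rewrite (bigD1 k) //= mxE (negPf xk) mul0r.
Qed.

Lemma dickeE (C : comNzRingType) (N n : nat) i :
  dicke C N n i 0 = (#|[set k | bits_of i k == 0]| == n)%:R.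
Proof.
rewrite summxE; under eq_bigr do rewrite tensor_ketE.
case: eqP => h.
  rewrite (bigD1 (bits_of i)) /=; last exact/eqP.
  by rewrite eqxx big1 ?addr0 // => x /andP[_]; rewrite eq_sym => /negPf->.
rewrite big1 // => x /eqP hx; case: eqVneq => // e.
by rewrite -e in hx.
Qed.

Lemma dicke_generating (C : comNzRingType) (N : nat) (z : C) :
  tensor_vec (fun _ : 'I_N => ket C 1 + z *: ket C 0) =
  \sum_(n < N.+1) z ^+ n *: dicke C N n.
Proof.
apply/colP => i; rewrite summxE mxE.
under [RHS]eq_bigr do rewrite mxE dickeE.
set A := [set k | _].
have cA : (#|A| < N.+1)%N by rewrite ltnS; apply: leq_trans (max_card _) _; rewrite card_ord.
rewrite (bigD1 (Ordinal cA)) //= eqxx mulr1 [X in _ = _ + X]big1 ?addr0.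
  rewrite -prodr_const [RHS]big_mkcond /=; apply: eq_bigr => k _.
  rewrite inE !mxE eqxx !andbT.
  case: (bits_of i k) => -[|[|//]] lt2 /=; rewrite -?val_eqE /=.
    by rewrite mulr1 add0r.
  by rewrite mulr0 addr0.
by move=> n; rewrite -val_eqE /= eq_sym => /negPf->; rewrite mulr0.
Qed.

(* Main.v *)
(* Necessity: transpose the first [m] qubits of a product state. Each tensor
   factor stays positive semidefinite, and on suitable test strings the entries
   of the partial transpose of [rho] are [chi (i + j + d)], so both Hankel
   matrices are sums of Schur products of positive semidefinite matrices.

   Sufficiency: for odd [N] the two Hankel matrices have the same size, and
   being positive semidefinite they can be diagonalised by one congruence,
   [M0 = Q^* a Q] and [M1 = Q^* (1 - a) Q]. The shift [M0 e_(j+1) = M1 e_j] then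
   forces [a q_(j+1) = (1 - a) q_j] on each row [q] of [Q], so [chi] is the moment
   sequence of a positive measure on [0, oo]. For even [N] one lowers [chi N] as
   far as possible and adds a moment [chi (N + 1)]. An atom of the measure yields
   the product vector [(sqrt (1 - x) |1> + sqrt x z |0>)^(x)N], averaged over
   the phases [z]. *)

Require Import Defs.
From mathcomp Require Import all_boot all_order all_algebra.
From mathcomp Require Import cyclic.
From mathcomp Require separable cyclotomic.
From mathcomp Require Import complex reals.
From mathcomp Require Import ring lra zify.

Set Implicit Arguments.
Unset Strict Implicit.
Unset Printing Implicit Defensive.

Import Order.TTheory GRing.Theory Num.Theory.
Local Open Scope ring_scope.
Local Open Scope sesquilinear_scope.

(** * Positive semidefinite matrices and pencils *)

Section PsdMatrices.
Variable C : numClosedFieldType.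

Lemma adjmxM m n p (A : 'M[C]_(m, n)) (B : 'M_(n, p)) :
  (A *m B) ^t* = B ^t* *m A ^t*.
Proof. by rewrite trmx_mul map_mxM. Qed.

Lemma adjmxE m n (A : 'M[C]_(m, n)) i j : (A ^t*) i j = (A j i)^*.
Proof. by rewrite !mxE. Qed.

Lemma adjmx_diag n (d : 'rV[C]_n) :
  (forall i, 0 <= d 0 i) -> (diag_mx d) ^t* = diag_mx d.
Proof.
move=> d0; rewrite tr_diag_mx map_diag_mx; congr diag_mx.
by apply/rowP => i; rewrite mxE; apply: CrealP; apply: ger0_real.
Qed.

Lemma psd_diag n (d : 'rV[C]_n) : (forall i, 0 <= d 0 i) -> psdmx (diag_mx d).
Proof.
move=> d0; split=> [|v]; first exact: adjmx_diag.
rewrite mul_mx_diag mxE sumr_ge0 // => i _.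
by rewrite !mxE mulrAC mulr_ge0 // mulrC mul_conjC_ge0.
Qed.

Lemma psd_add n (A B : 'M[C]_n) : psdmx A -> psdmx B -> psdmx (A + B).
Proof.
move=> [hA pA] [hB pB]; split=> [|v]; first by rewrite linearD map_mxD hA hB.
by rewrite mulmxDr mulmxDl mxE addr_ge0.
Qed.

Lemma psd_congr m n (A : 'M[C]_n) (G : 'M_(n, m)) :
  psdmx A -> psdmx (G ^t* *m A *m G).
Proof.
move=> [hA pA]; split=> [|v]; first by rewrite !adjmxM hA trmxCK mulmxA.
by have := pA (G *m v); rewrite adjmxM !mulmxA.
Qed.

Lemma psd_spectral n (A : 'M[C]_n) : psdmx A ->
  exists P : 'M[C]_n, exists s : 'rV[C]_n,
    [/\ P *m P ^t* = 1%:M, P ^t* *m P = 1%:M, forall i, 0 <= s 0 i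
      & A = P ^t* *m diag_mx s *m P].
Proof.
move=> [hA pA].
have Aherm : A \is hermsymmx.
  by apply/is_hermitianmxP; rewrite expr0 scale1r hA.
have /hermitian_normalmx/orthomx_spectralP := Aherm.
set P := spectralmx A; set s := spectral_diag A => eqA.
have uP : P \is unitarymx by apply: spectral_unitarymx.
have PP : P *m P ^t* = 1%:M by apply/unitarymxP.
rewrite invmx_unitary // in eqA.
exists P, s; split=> // [|i]; first exact: mulmx1C.
(* Testing the form on the [i]-th column of the adjoint of [P] returns the eigenvalue [s 0 i]. *)
have := pA (P ^t* *m delta_mx i 0); rewrite eqA adjmxM trmxCK.
rewrite !mulmxA -[_ *m P *m P ^t*]mulmxA PP mulmx1.
rewrite -[_ *m P *m P ^t*]mulmxA PP mulmx1.
rewrite mul_mx_diag mxE (bigD1 i) //= big1 ?addr0; last first.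
  by move=> j /negPf ij; rewrite !mxE ij /= mulr0.
by rewrite !mxE !eqxx /= conjC1 mul1r mulr1.
Qed.

Lemma psd_factor n (A : 'M[C]_n) : psdmx A ->
  exists F : 'M[C]_n, A = F ^t* *m F.
Proof.
move=> /psd_spectral[P [s [_ _ s0 ->]]].
exists (diag_mx (map_mx sqrtC s) *m P); rewrite adjmxM adjmx_diag; last first.
  by move=> i; rewrite mxE sqrtC_ge0.
rewrite !mulmxA -[_ *m diag_mx _ *m diag_mx _]mulmxA mulmx_diag.
congr (_ *m diag_mx _ *m _); apply/rowP => i.
by rewrite !mxE -expr2 sqrtCK.
Qed.

Lemma gram_add_eq0 m k n (X : 'M[C]_(m, n)) (Y : 'M_(k, n)) :
  X ^t* *m X + Y ^t* *m Y = 0 -> X = 0.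
Proof.
move=> XY; apply/matrixP => i j; rewrite [RHS]mxE.
have /eqP := congr1 (fun M : 'M_n => M j j) XY; rewrite !mxE.
have nn p (Z : 'M[C]_(p, n)) l : 0 <= (Z ^t*) j l * Z l j.
  by rewrite adjmxE mulrC mul_conjC_ge0.
rewrite paddr_eq0 ?sumr_ge0 // => /andP[]; rewrite psumr_eq0 //.
move=> /allP/(_ i); rewrite mem_index_enum => /(_ isT) /= /eqP.
rewrite adjmxE => /eqP; rewrite mulrC mul_conjC_eq0 => /eqP -> //.
Qed.

(** With [A = F^* F] and [B = G^* G], the hypothesis yields [(F W)^* (F W) + (G W)^* (G W) = 0], so
    [F W = 0]. *)
Lemma psd_addKer m n (A B : 'M[C]_n) (W : 'M_(n, m)) :
  psdmx A -> psdmx B -> (A + B) *m W = 0 -> A *m W = 0.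
Proof.
move=> /psd_factor[F ->] /psd_factor[G ->] FG.
suff FW : F *m W = 0 by rewrite -mulmxA FW mulmx0.
apply: (@gram_add_eq0 _ _ _ _ (G *m W)).
by rewrite !adjmxM -!mulmxA -mulmxDr !mulmxA -mulmxDl FG mulmx0.
Qed.

(* [A + B = F^* F] is turned into the identity on its range by the
   pseudo-inverse [G] of [F]; there [A] and [1 - A] are diagonalised together. *)
Lemma psd_pencil n (A B : 'M[C]_n) : psdmx A -> psdmx B ->
  exists Q : 'M[C]_n, exists a : 'rV[C]_n,
    [/\ forall l, 0 <= a 0 l <= 1,
        A = Q ^t* *m diag_mx a *m Q,
        B = Q ^t* *m diag_mx (const_mx 1 - a) *m Q
      & forall u v : 'cV_n, A *m u = B *m v ->
          diag_mx a *m Q *m u = diag_mx (const_mx 1 - a) *m Q *m v].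
Proof.
move=> pA pB; have [P [s [PP' P'P s0 eqS]]] := psd_spectral (psd_add pA pB).
pose d : 'rV[C]_n := map_mx sqrtC s.
pose d' : 'rV[C]_n := map_mx (fun x => (sqrtC x)^-1) s.
pose e : 'rV[C]_n := map_mx (fun x => (x != 0)%:R) s.
have d0 i : 0 <= d 0 i by rewrite mxE sqrtC_ge0.
have d'0 i : 0 <= d' 0 i by rewrite mxE invr_ge0 sqrtC_ge0.
have e0 i : 0 <= e 0 i by rewrite mxE ler0n.
pose F := diag_mx d *m P; pose G := P ^t* *m diag_mx d'; pose E := diag_mx e.
have F'F : F ^t* *m F = A + B.
  rewrite eqS /F adjmxM adjmx_diag // !mulmxA.
  rewrite -[_ *m diag_mx d *m diag_mx d]mulmxA mulmx_diag.
  by congr (_ *m diag_mx _ *m _); apply/rowP => i; rewrite !mxE -expr2 sqrtCK.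
have FG : F *m G = E.
  rewrite /F /G mulmxA -[_ *m P *m P ^t*]mulmxA PP' mulmx1 mulmx_diag.
  congr diag_mx; apply/rowP => i; rewrite !mxE.
  by case: eqVneq => [->|nz]; rewrite ?sqrtC0 ?mul0r // mulfV // sqrtC_eq0.
have EF : E *m F = F.
  rewrite /E /F mulmxA mulmx_diag; congr (diag_mx _ *m _).
  apply/rowP => i; rewrite !mxE.
  by case: eqVneq => [->|_]; rewrite ?sqrtC0 ?mulr0 ?mul1r.
have GE : G *m E = G.
  rewrite /E /G -mulmxA mulmx_diag; congr (_ *m diag_mx _).
  apply/rowP => i; rewrite !mxE.
  by case: eqVneq => [->|_]; rewrite ?sqrtC0 ?invr0 ?mul0r ?mulr1.
have E' : E ^t* = E by apply: adjmx_diag.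
have EE : E *m E = E.
  rewrite /E mulmx_diag; congr diag_mx; apply/rowP => i; rewrite !mxE.
  by case: eqVneq; rewrite ?mulr0 ?mulr1.
have eqE : diag_mx e = E by [].
clearbody F G E.
have EG' : E *m G ^t* = G ^t* by rewrite -E' -adjmxM GE.
have G'F' : G ^t* *m F ^t* = E by rewrite -adjmxM FG E'.
have [A1 eqA1G] : {A1 | A1 = G ^t* *m A *m G} by eexists.
have [B1 eqB1G] : {B1 | B1 = G ^t* *m B *m G} by eexists.
have AB1 : A1 + B1 = E.
  rewrite eqA1G eqB1G -mulmxDl -mulmxDr -F'F !mulmxA G'F' -mulmxA FG EE //.
(* [(A + B) (1 - G F) = F^* (F - E F) = 0], so [A] kills [1 - G F] as well. *)
have AGF : A *m (G *m F) = A.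
  apply/eqP; rewrite -subr_eq0 -[X in _ - X]mulmx1 -mulmxBr; apply/eqP.
  apply: (psd_addKer pA pB); rewrite -F'F mulmxBr mulmx1 -mulmxA.
  by rewrite (mulmxA F) FG EF subrr.
have eqA : A = F ^t* *m A1 *m F.
  rewrite eqA1G -!mulmxA AGF mulmxA -adjmxM; case: pA => hA _.
  by rewrite -[X in _ *m X]hA -adjmxM AGF hA.
have eqB : B = F ^t* *m (1%:M - A1) *m F.
  by rewrite mulmxBr mulmxBl mulmx1 -eqA F'F addrC addKr.
have [U [a [UU' U'U a0 eqA1]]] := psd_spectral (psd_congr G pA).
rewrite -eqA1G in eqA1.
(* [A1 + B1] is only the projection [E], so [1 - A1] is [B1] plus the complementary projection
   [1 - E]. *)
have psd1A1 : psdmx (1%:M - A1).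
  have -> : 1%:M - A1 = diag_mx (const_mx 1 - e) + B1.
    by rewrite linearB /= diag_const_mx eqE -AB1 opprD addrA subrK.
  apply: psd_add; last by rewrite eqB1G; apply: psd_congr.
  by apply: psd_diag => i; rewrite !mxE; case: (_ != 0); rewrite ?subrr ?subr0.
have eq1A1 : 1%:M - A1 = U ^t* *m diag_mx (const_mx 1 - a) *m U.
  by rewrite linearB /= diag_const_mx mulmxBr mulmxBl mulmx1 U'U -eqA1.
have a1 l : a 0 l <= 1.
  have [_ /(_ (delta_mx l 0))] := psd_congr (U ^t*) psd1A1.
  rewrite eq1A1 trmxCK !mulmxA -[_ *m U *m U ^t*]mulmxA UU' mulmx1.
  rewrite -[_ *m U *m U ^t*]mulmxA UU' !mulmx1.
  rewrite mul_mx_diag mxE (bigD1 l) //= big1 ?addr0; last first.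
    by move=> j /negPf jl; rewrite !mxE jl /= mulr0.
  by rewrite !mxE !eqxx /= conjC1 mul1r mulr1 subr_ge0.
exists (U *m F), a; split=> [l|||u v Auv].
- by rewrite a0 a1.
- by rewrite eqA eqA1 adjmxM !mulmxA.
- by rewrite eqB eq1A1 adjmxM !mulmxA.
have UA1 : U *m A1 = diag_mx a *m U by rewrite eqA1 !mulmxA UU' mul1mx.
have UB1 : U *m (1%:M - A1) = diag_mx (const_mx 1 - a) *m U.
  by rewrite eq1A1 !mulmxA UU' mul1mx.
(* It remains to see that [A1 F u = (1 - A1) F v]. The difference lies in the range of
   [E = G^* F^*], and [F^*] maps it to [A u - B v = 0]. *)
rewrite !mulmxA -UA1 -UB1 -!mulmxA; congr (U *m _); apply/eqP.
set z := A1 *m _; set z' := _ *m _; rewrite -subr_eq0; apply/eqP.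
have EA1 : E *m A1 = A1 by rewrite eqA1G !mulmxA EG'.
have Ez : E *m (z - z') = z - z'.
  rewrite mulmxBr /z /z' mulmxBl mul1mx mulmxBr.
  by rewrite !(mulmxA E) EA1 EF.
rewrite -Ez -G'F' -mulmxA mulmxBr /z /z' !mulmxA -eqA -eqB Auv.
by rewrite subrr mulmx0.
Qed.

End PsdMatrices.

(** * Real symmetric kernels and Hankel extension *)

Section Kernels.
Variable R : realFieldType.
Implicit Types (K : nat -> nat -> R) (v y z b : nat -> R).

(** Indexing by [nat] lets the size [n] vary without casts between ordinal types. *)
Definition kform n K v := \sum_(i < n) \sum_(j < n) v i * v j * K i j.

Definition psdker n K := forall v, 0 <= kform n K v.

Lemma eq_psdker n K K' :
  (forall i j, (i < n)%N -> (j < n)%N -> K i j = K' i j) ->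
  psdker n K -> psdker n K'.
Proof.
move=> KK' pK v; have := pK v; congr (_ <= _).
by apply: eq_bigr => i _; apply: eq_bigr => j _; rewrite KK'.
Qed.

Lemma kform_recr n K v : (forall i j, K i j = K j i) ->
  kform n.+1 K v =
  kform n K v + v n * (\sum_(i < n) v i * K i n) *+ 2 + v n ^+ 2 * K n n.
Proof.
move=> symK; rewrite /kform big_ord_recr /=.
under eq_bigr do rewrite big_ord_recr /=.
rewrite big_split big_ord_recr /= -!addrA; congr (_ + _).
rewrite mulr_sumr expr2; congr (_ + (_ + _)).
  by apply: eq_bigr => i _; ring.
by apply: eq_bigr => i _; rewrite (symK n i); ring.
Qed.

Lemma kform_shift n K v y c : (forall i j, K i j = K j i) ->
  kform n K (fun i => v i + c * y i) = kform n K v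
    + c * (\sum_(i < n) v i * (\sum_(j < n) K i j * y j)) *+ 2
    + c ^+ 2 * (\sum_(i < n) y i * (\sum_(j < n) K i j * y j)).
Proof.
move=> symK; rewrite /kform.
have sw : \sum_(i < n) \sum_(j < n) v j * y i * K i j =
          \sum_(i < n) v i * (\sum_(j < n) K i j * y j).
  rewrite exchange_big /=; apply: eq_bigr => i _; rewrite mulr_sumr.
  by apply: eq_bigr => j _; rewrite (symK j); ring.
rewrite mulr2n -{1}sw !mulr_sumr -!big_split /=; apply: eq_bigr => i _.
rewrite !mulr_sumr -!big_split /=; apply: eq_bigr => j _; ring.
Qed.

(** Fredholm alternative: a vector orthogonal to the kernel of a symmetric matrix lies in its range,
    as seen by testing it on the columns of the cokernel. *)
Lemma sym_solvable n K b : (forall i j, K i j = K j i) ->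
  (forall z, (forall i, (i < n)%N -> \sum_(j < n) K i j * z j = 0) ->
     \sum_(j < n) b j * z j = 0) ->
  exists y, forall i, (i < n)%N -> \sum_(j < n) K i j * y j = b i.
Proof.
move=> symK hb; pose A : 'M[R]_n := \matrix_(i, j) K i j.
pose nat_ext (f : 'I_n -> R) k := oapp f 0 (insub k).
have nat_extE f (i : 'I_n) : nat_ext f i = f i by rewrite /nat_ext valK.
pose r : 'rV[R]_n := \row_j b j.
have /submxP[D rD] : (r <= A)%MS.
  rewrite submxE; apply/eqP/rowP => k; rewrite !mxE.
  rewrite -[RHS](hb (nat_ext (fun j => cokermx A j k))) => [|i ltin].
    by apply: eq_bigr => j _; rewrite mxE nat_extE.
  have /matrixP/(_ (Ordinal ltin) k) := mulmx_coker A; rewrite !mxE => AC.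
  by rewrite -[RHS]AC; apply: eq_bigr => j _; rewrite mxE nat_extE.
exists (nat_ext (D 0)) => i ltin.
have /rowP/(_ (Ordinal ltin)) := rD; rewrite !mxE /= => ->.
by apply: eq_bigr => j _; rewrite nat_extE mxE symK mulrC.
Qed.

(** If a kernel vector [z] of the leading block had a nonzero product [t] with the last column, the
    form would be negative at [(z, - t / D)], where [D > K n n]. *)
Lemma psdker_range n K : (forall i j, K i j = K j i) -> psdker n.+1 K ->
  exists y, forall i, (i < n)%N -> \sum_(j < n) K i j * y j = K i n.
Proof.
move=> symK pK; apply: sym_solvable => // z Kz.
set t := \sum_(j < n) _; pose D := `|K n n| + 1.
have D0 : 0 < D by rewrite ltr_wpDl.
pose v k := if k == n then - t / D else z k.
have := pK v; rewrite kform_recr //.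
have vE (i : 'I_n) : v i = z i by rewrite /v ltn_eqF.
have -> : kform n K v = 0.
  rewrite /kform big1 // => i _.
  rewrite -[RHS](mulr0 (v i)) -[in RHS](Kz i) // mulr_sumr.
  by apply: eq_bigr => j _; rewrite !vE; ring.
have -> : \sum_(i < n) v i * K i n = t.
  by apply: eq_bigr => i _; rewrite vE mulrC.
rewrite /v eqxx add0r => h.
have le : (- t / D) ^+ 2 * K n n <= (- t / D) ^+ 2 * D.
  by rewrite ler_wpM2l ?sqr_ge0 // /D (le_trans (ler_norm _)) // lerDl.
have e2 : (- t / D) ^+ 2 * D = t ^+ 2 / D by field; rewrite gt_eqF.
have e1 : - t / D * t *+ 2 = - (t ^+ 2 / D) *+ 2 by field; rewrite gt_eqF.
rewrite e1 in h; rewrite e2 in le.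
have : t ^+ 2 / D <= 0 by move: h le; set q := t ^+ 2 / D; lra.
rewrite pmulr_lle0 ?invr_gt0 // => t2.
by apply/eqP; rewrite -sqrf_eq0 eq_le t2 sqr_ge0.
Qed.

(** The form at [(y, -1)] is the Schur complement of the leading block. *)
Lemma psdker_schur n K y : (forall i j, K i j = K j i) -> psdker n.+1 K ->
  (forall i, (i < n)%N -> \sum_(j < n) K i j * y j = K i n) ->
  \sum_(i < n) y i * K i n <= K n n.
Proof.
move=> symK pK Ky; pose v k := if k == n then -1 else y k.
have := pK v; rewrite kform_recr //.
have vE (i : 'I_n) : v i = y i by rewrite /v ltn_eqF.
have -> : kform n K v = \sum_(i < n) y i * K i n.
  apply: eq_bigr => i _; rewrite -Ky // mulr_sumr.
  by apply: eq_bigr => j _; rewrite !vE; ring.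
under [X in _ * X *+ 2]eq_bigr do rewrite vE.
by rewrite /v eqxx; lra.
Qed.

(** Completing the square: the form at [v] is the leading form at [v + v n * y] plus [v n ^+ 2]
    times the Schur complement. *)
Lemma psdker_ext n K y : (forall i j, K i j = K j i) -> psdker n K ->
  (forall i, (i < n)%N -> \sum_(j < n) K i j * y j = K i n) ->
  \sum_(i < n) y i * K i n <= K n n -> psdker n.+1 K.
Proof.
move=> symK pK Ky le v; rewrite kform_recr //.
have := pK (fun i => v i + v n * y i); rewrite kform_shift //.
under [X in _ * X *+ 2]eq_bigr do rewrite Ky //.
under [X in _ + _ ^+ 2 * X]eq_bigr do rewrite Ky //.
move=> h; apply: le_trans h _; rewrite lerD2l.
by rewrite ler_wpM2l ?sqr_ge0.
Qed.

(* Once [chi (2m)] is lowered until the first Hankel matrix gets a kernel vector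
   [(y, -1)], the last column needed by the second one lies in its range. *)
Lemma hankel_extend m (chi : nat -> R) :
  psdker m.+1 (fun i j => chi (i + j)%N) ->
  psdker m (fun i j => chi (i + j).+1) ->
  exists chi' : nat -> R,
    [/\ forall n, (n < m + m)%N -> chi' n = chi n,
        chi' (m + m)%N <= chi (m + m)%N,
        psdker m.+1 (fun i j => chi' (i + j)%N)
      & psdker m.+1 (fun i j => chi' (i + j).+1)].
Proof.
move=> p0 p1.
have sym0 (f : nat -> R) i j : f (i + j)%N = f (j + i)%N by rewrite addnC.
have sym1 (f : nat -> R) i j : f (i + j).+1 = f (j + i).+1 by rewrite addnC.
have [y Ky] := psdker_range (sym0 chi) p0.
have lec := psdker_schur (sym0 chi) p0 Ky.
set c := \sum_(i < m) _ in lec.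
pose chi1 n := if n == (m + m)%N then c else chi n.
have chi1E n : (n < m + m)%N -> chi1 n = chi n by move=> h; rewrite /chi1 ltn_eqF.
have Ky1 i : (i < m)%N -> \sum_(j < m) chi1 (i + j)%N * y j = chi1 (i + m)%N.
  move=> im; rewrite chi1E ?ltn_add2r // -Ky //.
  by apply: eq_bigr => j _; rewrite chi1E // -addnS leq_add // ltnW.
have c1 : \sum_(i < m) y i * chi1 (i + m)%N = chi1 (m + m)%N.
  rewrite {2}/chi1 eqxx; apply: eq_bigr => i _; rewrite chi1E // ltn_add2r //.
have p01 : psdker m.+1 (fun i j => chi1 (i + j)%N).
  apply: psdker_ext Ky1 _ => //; last by rewrite c1.
  apply: (eq_psdker (K := fun i j => chi (i + j)%N)) => [i j im jm|v].
    by rewrite chi1E // -addnS leq_add // ltnW.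
  have := p0 (fun i => if i == m then 0 else v i); rewrite kform_recr // eqxx.
  rewrite mul0r mul0rn expr0n mul0r !addr0; congr (_ <= _).
  by apply: eq_bigr => i _; apply: eq_bigr => j _; rewrite !ltn_eqF.
have p11 : psdker m (fun i j => chi1 (i + j).+1).
  apply: eq_psdker p1 => i j im jm; rewrite chi1E //; lia.
(* The relation given by [y], read at row [j + 1], writes the new column as the shifted block
   applied to [y], so it is orthogonal to the kernel. For [j + 1 = m] this uses the lowered corner
   [c]. *)
have [y1 Ky2] : exists y1, forall i, (i < m)%N ->
    \sum_(j < m) chi1 (i + j).+1 * y1 j = chi1 (i + m).+1.
  apply: (sym_solvable (b := fun i => chi1 (i + m).+1) (sym1 chi1)) => z Kz.
  have yKz : \sum_(i < m) y i * (\sum_(j < m) chi1 (i + j).+1 * z j) = 0.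
    by rewrite big1 // => i _; rewrite Kz // mulr0.
  rewrite -[RHS]yKz; under [RHS]eq_bigr do rewrite mulr_sumr.
  rewrite exchange_big /=; apply: eq_bigr => j _.
  rewrite -addSn; have [jm|jm] := ltnP j.+1 m.
    rewrite -Ky1 // mulr_suml; apply: eq_bigr => i _.
    by rewrite addSn (addnC j); ring.
  have -> : j.+1 = m by apply/eqP; rewrite eqn_leq jm ltn_ord.
  rewrite -c1 mulr_suml; apply: eq_bigr => i _.
  have -> : (i + j).+1 = (i + m)%N by have := ltn_ord j; lia.
  ring.
pose c2 := \sum_(i < m) y1 i * chi1 (i + m).+1.
pose chi2 n := if n == (m + m).+1 then c2 else chi1 n.
have chi2E n : (n <= m + m)%N -> chi2 n = chi1 n.
  by move=> h; rewrite /chi2 ltn_eqF.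
exists chi2; split=> [n nm|||].
- by rewrite chi2E ?chi1E // ltnW.
- by rewrite chi2E // /chi1 eqxx.
- by apply: eq_psdker p01 => i j im jm; rewrite chi2E // leq_add.
apply: (psdker_ext (y := y1)) => // [|i im|].
- by apply: eq_psdker p11 => i j im jm; rewrite chi2E //; lia.
- rewrite chi2E ?ltn_add2r // -Ky2 //; apply: eq_bigr => j _.
  by rewrite chi2E //; have := ltn_ord j; lia.
rewrite {2}/chi2 eqxx /c2 ler_sum // => i _.
by rewrite chi2E // ltn_add2r.
Qed.

End Kernels.

(** * Moments of a diagonalised Hankel pencil *)

Section Moments.
Variable C : numClosedFieldType.

(** For [a != 0] the recursion gives [q j = ((1 - a) / a) ^ j * q 0], and [w = |q 0|^2 / a ^ (2m)].
    For [a = 0] only [q m] can be nonzero, and [w = |q m|^2]. *)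
Lemma geometric_weight m (a : C) (q : nat -> C) : 0 <= a <= 1 ->
  (forall j, (j < m)%N -> a * q j.+1 = (1 - a) * q j) ->
  exists w : C, 0 <= w /\ forall i j, (i <= m)%N -> (j <= m)%N ->
    (q i)^* * a * q j
      = w * (1 - a) ^+ (i + j) * a ^+ ((m + m).+1 - (i + j)) /\
    (q i)^* * (1 - a) * q j
      = w * (1 - a) ^+ (i + j).+1 * a ^+ ((m + m).+1 - (i + j).+1).
Proof.
case/andP=> a0 a1 qS; have [az|anz] := eqVneq a 0.
  have q0 j : (j < m)%N -> q j = 0.
    by move=> /qS; rewrite az subr0 mul0r mul1r.
  exists (q m * (q m)^*); split=> [|i j im jm]; first exact: mul_conjC_ge0.
  rewrite az subr0 !expr1n !mulr1 mulr0 mul0r subSn ?leq_add //.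
  rewrite exprS mul0r mulr0; split=> //; rewrite subSS.
  have [ijm|ijm] := ltnP (i + j) (m + m).
    have -> : (m + m - (i + j) = (m + m - (i + j)).-1.+1)%N by lia.
    rewrite exprS mul0r mulr0; have [/q0->|mi] := ltnP i m.
      by rewrite conjC0 mul0r.
    by rewrite (q0 j) ?mulr0 //; lia.
  have -> : i = m by lia.
  have -> : j = m by lia.
  by rewrite subnn mulr1 mulrC.
have aC : a^* = a by apply/CrealP/ger0_real.
have bC : (1 - a)^* = 1 - a by apply/CrealP/ger0_real; rewrite subr_ge0.
have qE j : (j <= m)%N -> a ^+ j * q j = (1 - a) ^+ j * q 0%N.
  elim: j => [|j IH] jm; first by rewrite !expr0.
  by rewrite exprSr -mulrA qS // mulrCA IH 1?ltnW // mulrA -exprS.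
have am : a ^+ (m + m) != 0 by rewrite expf_neq0.
exists (q 0%N * (q 0%N)^* / a ^+ (m + m)); split=> [|i j im jm].
  by rewrite divr_ge0 ?mul_conjC_ge0 ?exprn_ge0.
have key : a ^+ (i + j) * ((q i)^* * q j)
    = (1 - a) ^+ (i + j) * (q 0%N * (q 0%N)^*).
  have e1 : a ^+ i * (q i)^* = (1 - a) ^+ i * (q 0%N)^*.
    by rewrite -[in LHS]aC -[in RHS]bC -!rmorphXn -!rmorphM qE.
  rewrite !exprD mulrACA e1 qE //; ring.
have e2 : a ^+ (m + m) = a ^+ (m + m - (i + j)) * a ^+ (i + j).
  by rewrite -exprD subnK // leq_add.
have e3 : q 0%N * (q 0%N)^* / a ^+ (m + m) * (1 - a) ^+ (i + j)
    * a ^+ (m + m - (i + j)) = (q i)^* * q j.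
  apply: (mulfI am); rewrite [in RHS]e2 -[RHS]mulrA key.
  by move: am; set t := a ^+ (m + m) => am; field.
rewrite subSn ?leq_add // subSS exprS; split.
  by rewrite [a * a ^+ _]mulrC mulrA e3; ring.
rewrite exprS -[LHS]mulrAC -e3; ring.
Qed.

(* The Hankel shift turns the diagonalised pencil into a geometric recursion
   on each row; rows with [a = 0] give the atom at infinity. *)
Lemma odd_moments m (chi : nat -> C) :
  psdmx (\matrix_(i < m.+1, j < m.+1) chi (i + j)%N) ->
  psdmx (\matrix_(i < m.+1, j < m.+1) chi (i + j).+1) ->
  exists a w : 'I_m.+1 -> C,
    (forall l, 0 <= a l <= 1 /\ 0 <= w l) /\
    forall n, (n <= (m + m).+1)%N ->
      chi n = \sum_l w l * (1 - a l) ^+ n * a l ^+ ((m + m).+1 - n).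
Proof.
set A := \matrix_(i, j) _; set B := \matrix_(i, j) _ => pA pB.
have [Q [a [a01 eqA eqB AB]]] := psd_pencil pA pB.
have QS l j : (j < m)%N ->
    a 0 l * Q l (inord j.+1) = (1 - a 0 l) * Q l (inord j).
  move=> jm; have Auv : A *m delta_mx (inord j.+1) (0 : 'I_1)
             = B *m delta_mx (inord j) 0.
    apply/colP => i; rewrite -!colE !mxE !inordK ?addnS //; lia.
  have /colP/(_ l) := AB _ _ Auv; rewrite -!mulmxA -!colE !mul_diag_mx !mxE //.
have /fin_all_exists[w hw] l := geometric_weight (a01 l) (QS l).
exists (fun l => a 0 l), w; split=> [l|n nm].
  by split; [apply: a01 | case: (hw l)].
have entry (d : 'rV[C]_m.+1) (i j : 'I_m.+1) :
    (Q ^t* *m diag_mx d *m Q) i j = \sum_l (Q l i)^* * d 0 l * Q l j.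
  by rewrite mxE; apply: eq_bigr => l _; rewrite mul_mx_diag !mxE.
(* Every [n <= 2m] is a sum of two indices at most [m]; only [n = 2m + 1] needs the second
   matrix. *)
have [n2m|n2m] := leqP n (m + m).
  pose i := minn n m; pose j := (n - i)%N.
  have im : (i <= m)%N by rewrite /i; lia.
  have jm : (j <= m)%N by rewrite /j /i; lia.
  have ijn : (i + j = n)%N by rewrite /j /i; lia.
  have := congr1 (fun M : 'M_m.+1 => M (inord i) (inord j)) eqA.
  rewrite entry mxE !inordK // ijn => ->; apply: eq_bigr => l _.
  by have [_ /(_ i j im jm)[-> _]] := hw l; rewrite ijn.
have nE : n = (m + m).+1 by lia.
have := congr1 (fun M : 'M_m.+1 => M (inord m) (inord m)) eqB.
rewrite entry mxE !inordK // -nE => ->; apply: eq_bigr => l _.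
by have [_ /(_ m m (leqnn m) (leqnn m))[_]] := hw l; rewrite !mxE -nE.
Qed.

End Moments.

(** * The truncated moment problem *)

Section RealMoments.
Variable R : rcfType.

(** The real part of the form is the sum of the real forms at [re] and [im]; the imaginary part
    cancels by symmetry of [K]. *)
Lemma psdmx_complexify n (K : nat -> nat -> R) :
  (forall i j, K i j = K j i) -> psdker n K ->
  psdmx (\matrix_(i < n, j < n) (K i j)%:C%C).
Proof.
move=> symK pK; split=> [|v].
  apply/matrixP => i j; rewrite !mxE symK; apply/CrealP.
  by rewrite complex_real.
pose re i := oapp (fun k : 'I_n => complex.Re (v k 0)) 0 (insub i).
pose im i := oapp (fun k : 'I_n => complex.Im (v k 0)) 0 (insub i).
have reE (i : 'I_n) : re i = complex.Re (v i 0) by rewrite /re valK.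
have imE (i : 'I_n) : im i = complex.Im (v i 0) by rewrite /im valK.
have -> : (v ^t* *m \matrix_(i, j) (K i j)%:C%C *m v) 0 0
    = (kform n K re + kform n K im)%:C%C + 'i%C *
      (\sum_(j < n) \sum_(i < n) (re i * im j * K i j - im i * re j * K i j))%:C%C.
  rewrite mxE [kform n K re]exchange_big [kform n K im]exchange_big /=.
  rewrite -big_split !rmorph_sum mulr_sumr -big_split /=; apply: eq_bigr => j _.
  rewrite mxE mulr_suml -big_split !rmorph_sum mulr_sumr -big_split /=.
  apply: eq_bigr => i _; rewrite !mxE !reE !imE.
  case: (v i 0) (v j 0) => [a b] [c d] /=.
  by apply/eqP; rewrite eq_complex /=; apply/andP; split; apply/eqP; ring.
under eq_bigr do rewrite sumrB.
rewrite sumrB [X in _ - X]exchange_big /=.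
have -> : \sum_(j < n) \sum_(i < n) re i * im j * K i j
    = \sum_(j < n) \sum_(i < n) im j * re i * K j i.
  by apply: eq_bigr => j _; apply: eq_bigr => i _; rewrite symK; ring.
by rewrite subrr rmorph0 mulr0 addr0 ler0c addr_ge0.
Qed.

(* The homogeneous form of [chi n = \int t ^ n] with [t = x / (1 - x)]; [x = 1] is
   the atom at infinity, which only contributes to [chi N]. *)
Definition atomic N (chi : nat -> R) := exists s (x w : 'I_s -> R),
  (forall l, 0 <= x l <= 1 /\ 0 <= w l) /\
  forall n, (n <= N)%N ->
    chi n = \sum_l w l * x l ^+ n * (1 - x l) ^+ (N - n).

Lemma atomic_odd m (chi : nat -> R) :
  psdker m.+1 (fun i j => chi (i + j)%N) ->
  psdker m.+1 (fun i j => chi (i + j).+1) ->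
  atomic (m + m).+1 chi.
Proof.
move=> p0 p1.
have [||a [w [aw chiE]]] := @odd_moments _ m (fun n => (chi n)%:C%C).
- by apply: (@psdmx_complexify _ (fun i j => chi (i + j)%N)) => // i j; rewrite addnC.
- by apply: (@psdmx_complexify _ (fun i j => chi (i + j).+1)) => // i j; rewrite addnC.
have real_ge0 (z : R[i]) : 0 <= z -> exists2 r : R, z = r%:C%C & 0 <= r.
  move=> z0; exists (complex.Re z); first by rewrite RRe_real // ger0_real.
  by move: z0; rewrite lecE /= => /andP[].
have /fin_all_exists[a' a'E] l : exists r : R, a l = r%:C%C /\ 0 <= r <= 1.
  have [/andP[/real_ge0[r ar r0] al1] _] := aw l.
  exists r; split=> //; rewrite r0 /=.
  by move: al1; rewrite ar -(rmorph1 (real_complex R)) lecR.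
have /fin_all_exists[w' w'E] l : exists r : R, w l = r%:C%C /\ 0 <= r.
  by have [_ /real_ge0[r]] := aw l; exists r.
(* In [odd_moments] the exponent [n] sits on [1 - a], so the atom is [x = 1 - a]. *)
exists m.+1, (fun l => 1 - a' l), w'; split=> [l|n nN].
  have [_ /andP[h0 h1]] := a'E l; split; last by case: (w'E l).
  by rewrite subr_ge0 h1 gerBl.
apply: complexI; rewrite /= chiE // rmorph_sum; apply: eq_bigr => l _.
have [-> _] := a'E l; have [-> _] := w'E l.
by rewrite subKr !rmorphM !rmorphXn rmorphB rmorph1.
Qed.

(** The spare factor [1 - x] moves into the weight. *)
Lemma atomic_widen N (chi chi' : nat -> R) :
  (forall n, (n <= N)%N -> chi n = chi' n) ->
  atomic N.+1 chi' -> atomic N chi.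
Proof.
move=> chichi' [s [x [w [xw chiE]]]].
exists s, x, (fun l => w l * (1 - x l)); split=> [l|n nN].
  have [/andP[x0 x1] w0] := xw l; rewrite x0 x1; split=> //.
  by rewrite mulr_ge0 ?subr_ge0.
rewrite chichi' // chiE 1?leqW //; apply: eq_bigr => l _.
by rewrite subSn // exprS; ring.
Qed.

(** An extra atom at [x = 1] carries the missing mass: there [(1 - x) ^ (N - n)] vanishes unless
    [n = N]. *)
Lemma atomic_infinity N (chi chi' : nat -> R) :
  (forall n, (n < N)%N -> chi' n = chi n) -> chi' N <= chi N ->
  atomic N chi' -> atomic N chi.
Proof.
move=> lt le [s [x [w [xw chiE]]]].
pose ext (d : R) (f : 'I_s -> R) l := oapp f d (unlift ord0 l).
have ext0 d f : ext d f ord0 = d by rewrite /ext unlift_none.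
have extS d f l : ext d f (lift ord0 l) = f l by rewrite /ext liftK.
exists s.+1, (ext 1 x), (ext (chi N - chi' N) w); split=> [l|n nN].
  case: (unliftP ord0 l) => [k ->|->]; first by rewrite !extS.
  by rewrite !ext0 ler01 lexx subr_ge0.
rewrite big_ord_recl !ext0; under eq_bigr do rewrite !extS.
rewrite -chiE // subrr expr1n mulr1; case: ltngtP nN => // [nN|->] _.
  by rewrite -subnSK // exprS mul0r mulr0 add0r lt.
by rewrite subnn mulr1 subrK.
Qed.

Lemma hankel_atomic N (chi : nat -> R) :
  psdker N./2.+1 (fun i j => chi (i + j)%N) ->
  psdker N.+1./2 (fun i j => chi (i + j).+1) ->
  atomic N chi.
Proof.
rewrite -[N]odd_double_half; case: (odd N); move: (N./2) => m.
  rewrite /= add1n uphalf_half odd_double !doubleK /= add0n -addnn.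
  exact: atomic_odd.
rewrite add0n /= uphalf_half odd_double add0n doubleK -addnn => p0 p1.
(* Even case: pass to order [2m + 1], drop the top moment, then restore [chi N] by an atom at
   infinity. *)
have [chi' [lt le p0' p1']] := hankel_extend p0 p1.
apply: atomic_infinity lt le _.
by apply: (@atomic_widen _ _ chi') => //; apply: atomic_odd.
Qed.

End RealMoments.

(** * Separability of atomic states *)

Section DickeStates.
Variable R : realType.
Implicit Types (N : nat) (chi : nat -> R).

Definition zeros N (i : 'I_(dimq N)) : nat := #|[set k | bits_of i k == 0]|.

Lemma zeros_leq N (i : 'I_(dimq N)) : (zeros i <= N)%N.
Proof. by rewrite -[leqRHS]card_ord max_card. Qed.

Lemma diag_symE N chi i j :
  diag_sym N chi i j = (chi (zeros i))%:C%C *+ (zeros i == zeros j).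
Proof.
rewrite summxE.
rewrite (bigD1 (inord (zeros i) : 'I_N.+1)) //= big1 => [|n neq].
  rewrite addr0 inordK ?ltnS ?zeros_leq //.
  rewrite mxE mxE big_ord1 dickeE mxE mxE dickeE -/(zeros i) -/(zeros j).
  by rewrite eqxx mul1r conjC_nat eq_sym mulr_natr.
rewrite mxE mxE big_ord1 dickeE -/(zeros i).
case: eqP => [zn|]; last by rewrite mul0r mulr0.
by case/eqP: neq; apply/val_inj; rewrite /= inordK zn.
Qed.

Lemma mxtrace_tensor_op (C : comNzRingType) N (A : 'I_N -> 'M[C]_2) :
  \tr (tensor_op A) = \prod_k \tr (A k).
Proof.
rewrite bigA_distr_bigA /= /mxtrace.
rewrite (reindex (@enum_rank {ffun 'I_N -> 'I_2})) /=; last first.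
  by apply: onW_bij; apply: enum_rank_bij.
apply: eq_bigr => f _; rewrite mxE; apply: eq_bigr => k _.
by rewrite /bits_of enum_rankK.
Qed.

(** Product states have trace one, so [\tr rho = 1] forces the weights to sum to one. *)
Lemma separable_fin N (I : finType) (p : I -> R) (alpha : I -> 'I_N -> 'M[R[i]]_2)
    (rho : 'M[R[i]]_(dimq N)) :
  (forall l, 0 <= p l) -> (forall l k, is_state (alpha l k)) -> \tr rho = 1 ->
  rho = \sum_l (p l)%:C%C *: tensor_op (alpha l) -> separable rho.
Proof.
move=> p0 st tr1 rhoE.
exists #|I|, (fun l => p (enum_val l)), (fun l => alpha (enum_val l)).
have val_bij : {on [pred l | true], bijective (@enum_val I I)}.
  by apply: onW_bij; apply: enum_val_bij.
split=> //; last by rewrite rhoE [LHS](reindex (@enum_val I I)).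
apply: complexI; rewrite rmorph1 -tr1 rhoE !raddf_sum /=.
rewrite [RHS](reindex (@enum_val I I)) //.
apply: eq_bigr => l _; rewrite mxtraceZ mxtrace_tensor_op big1 ?mulr1 //.
by move=> k _; case: (st (enum_val l) k).
Qed.

(** In characteristic zero [X^n - 1] has [n] distinct roots, and [n] distinct [n]-th roots of unity
    include a primitive one. *)
Lemma prim_root_exists (C : numClosedFieldType) n : (0 < n)%N ->
  exists z : C, n.-primitive_root z.
Proof.
move=> n0; have [rs rsE] := closed_field_poly_normal ('X^n - 1 : {poly C}).
have mon : lead_coef ('X^n - 1 : {poly C}) = 1 by apply/eqP/monicXnsubC.
rewrite mon scale1r in rsE.
suff /hasP[z _ zP] : has n.-primitive_root rs by exists z.
apply: has_prim_root => //.
- by apply/allP => z; rewrite -root_prod_XsubC -rsE.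
- rewrite -separable.separable_prod_XsubC -rsE cyclotomic.separable_Xn_sub_1 //.
  by rewrite pnatr_eq0 -lt0n.
by have := size_prod_XsubC rs id; rewrite -rsE size_XnsubC // => -[->].
Qed.

Lemma prim_root_mulconj (C : numClosedFieldType) n (z : C) : (0 < n)%N ->
  n.-primitive_root z -> z * z^* = 1.
Proof.
move=> n0 /prim_expr_order zn; rewrite -normCK.
suff -> : `|z| = 1 by rewrite expr1n.
by apply/eqP; rewrite -(pexpr_eq1 n0) // -normrX zn normr1.
Qed.

(** Orthogonality of characters: a geometric sum of ratio [y = z ^ (a - b)], which is [1] only if
    [a = b] because [a, b < n]. *)
Lemma sum_prim_root_expr (C : numClosedFieldType) n (z : C) a b :
  n.-primitive_root z -> (a < n)%N -> (b < n)%N ->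
  \sum_(r < n) (z ^+ r) ^+ a * ((z ^+ r) ^+ b)^* = n%:R *+ (a == b).
Proof.
move=> zP an bn; have n0 : (0 < n)%N by apply: leq_trans bn.
have zz := prim_root_mulconj n0 zP.
pose y := z ^+ a * (z ^+ b)^*.
have -> : \sum_(r < n) (z ^+ r) ^+ a * ((z ^+ r) ^+ b)^* = \sum_(r < n) y ^+ r.
  by apply: eq_bigr => r _; rewrite exprMn -rmorphXn (exprAC z a) (exprAC z b).
case: (eqVneq a b) => [ab|neq].
  have -> : y = 1 by rewrite /y ab rmorphXn -exprMn zz expr1n.
  by under eq_bigr do rewrite expr1n; rewrite sumr_const card_ord mulr1n.
have y1 : y - 1 != 0.
  rewrite subr_eq0; apply: contraNneq neq => /(congr1 ( *%R^~ (z ^+ b))).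
  rewrite /y -mulrA [_^* * _]mulrC rmorphXn -exprMn zz expr1n mulr1 mul1r.
  by move=> /eqP; rewrite (eq_prim_root_expr zP) !modn_small.
apply: (mulfI y1); rewrite -subrX1 mulr0n mulr0 /y exprMn -rmorphXn.
rewrite (exprAC z a) (exprAC z b) (prim_expr_order zP) !expr1n rmorph1 mulr1 subrr //.
Qed.

Definition phase_ket (x : R) (z : R[i]) : 'cV[R[i]]_2 :=
  \col_a (if a == 0 then (Num.sqrt x)%:C%C * z else (Num.sqrt (1 - x))%:C%C).

Lemma phase_ket_state (x : R) (z : R[i]) : 0 <= x <= 1 -> z * z^* = 1 ->
  is_state (phase_ket x z *m (phase_ket x z) ^t*).
Proof.
case/andP=> x0 x1 zz; split.
  rewrite -[X in X *m _]trmxCK -[X in X *m _]mulmx1; apply: psd_congr.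
  by rewrite -diag_const_mx; apply: psd_diag => i; rewrite mxE.
have sqrE (y : R) : 0 <= y ->
    (Num.sqrt y)%:C%C * ((Num.sqrt y)%:C%C)^* = y%:C%C :> R[i].
  move=> y0; have -> : ((Num.sqrt y)%:C%C)^* = (Num.sqrt y)%:C%C :> R[i].
    by apply/CrealP; rewrite complex_real.
  by rewrite -rmorphM /= -expr2 sqr_sqrtr.
rewrite /mxtrace big_ord_recl big_ord1 !mxE !big_ord1 !mxE /=.
rewrite rmorphM mulrACA zz mulr1 !sqrE ?subr_ge0 //.
by rewrite -rmorphD /= addrC subrK.
Qed.

Lemma prod_phase_ket N (x : R) (z : R[i]) (i : 'I_(dimq N)) :
  \prod_(k < N) phase_ket x z (bits_of i k) 0
    = ((Num.sqrt x) ^+ zeros i * (Num.sqrt (1 - x)) ^+ (N - zeros i))%:C%C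
      * z ^+ zeros i.
Proof.
under eq_bigr do rewrite mxE.
rewrite (bigID (fun k => bits_of i k == 0)) /=.
under eq_bigr => k ik do rewrite ik.
under [X in _ * X]eq_bigr => k ik do rewrite (negPf ik).
have c0 : #|[pred k | bits_of i k == 0]| = zeros i by rewrite /zeros cardsE.
have c1 : #|[pred k | bits_of i k != 0]| = (N - zeros i)%N.
  rewrite -c0 -[X in (X - _)%N](card_ord N) -(cardC [pred k | bits_of i k == 0]).
  by rewrite addKn.
by rewrite !prodr_const c0 c1 exprMn rmorphM !rmorphXn mulrAC.
Qed.

(* Averaging [(|1> + z |0>)^(x)N] over the (N+1)-st roots of unity kills the
   coherences between different excitation numbers. *)
Lemma atomic_separable N chi :
  \tr (diag_sym N chi) = 1 -> atomic N chi -> separable (diag_sym N chi).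
Proof.
move=> tr1 [s [x [w [xw chiE]]]].
(* The number of zeros ranges over [0, ..., N], so [N + 1] phases separate all its values. *)
have [z zP] := prim_root_exists R[i] (ltn0Sn N).
pose ket (l : 'I_s * 'I_N.+1) := phase_ket (x l.1) (z ^+ l.2).
apply: (@separable_fin _ _ (fun l => w l.1 / N.+1%:R)
         (fun l _ => ket l *m (ket l) ^t*)) => // [l|l k|].
- by rewrite divr_ge0 ?ler0n //; case: (xw l.1).
- apply: phase_ket_state; first by case: (xw l.1).
  by rewrite rmorphXn -exprMn (prim_root_mulconj _ zP) ?expr1n.
apply/matrixP => i j; rewrite diag_symE summxE.
pose c (l : 'I_s) (n : nat) : R :=
  Num.sqrt (x l) ^+ n * Num.sqrt (1 - x l) ^+ (N - n).
(* Only the phases depend on [r], so the inner sum becomes a character sum. *)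
transitivity (\sum_(l < s) \sum_(r < N.+1)
   (w l / N.+1%:R * c l (zeros i) * c l (zeros j))%:C%C *
   ((z ^+ r) ^+ zeros i * ((z ^+ r) ^+ zeros j)^*)); last first.
  rewrite pair_bigA; apply: eq_bigr => -[l r] _ /=; rewrite !mxE.
  under [in RHS]eq_bigr do rewrite !mxE big_ord1 adjmxE.
  rewrite big_split /= -rmorph_prod !prod_phase_ket /= -!/(c _ _).
  rewrite [X in _ = _ * (_ * X)]rmorphM /=; set cj := (c l (zeros j))%:C%C.
  have -> : cj^* = cj by apply/CrealP; rewrite complex_real.
  by rewrite rmorphM rmorphM /= mulrACA !mulrA.
under eq_bigr do rewrite -mulr_sumr sum_prim_root_expr ?ltnS ?zeros_leq //.
case: eqVneq => [<-|_]; last by rewrite mulr0n big1 // => l _; rewrite mulr0.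
rewrite !mulr1n chiE ?zeros_leq // rmorph_sum; apply: eq_bigr => l _.
rewrite -(rmorph_nat (real_complex R)) -rmorphM /=; congr (_%:C%C).
have [/andP[x0 x1] _] := xw l.
have cc : c l (zeros i) * c l (zeros i) = x l ^+ zeros i * (1 - x l) ^+ (N - zeros i).
  by rewrite /c mulrACA -!exprMn -!expr2 !sqr_sqrtr ?subr_ge0.
rewrite -mulrA -cc; field; rewrite addrC natr1 pnatr_eq0 //.
Qed.

End DickeStates.

(** * Partial transposition *)

Section PartialTranspose.

Lemma sum_interval N a b : (b <= N)%N ->
  (\sum_(k < N) (a <= k < b) = b - a)%N.
Proof.
(* The induction on [N] passes through intervals cut off at [N], hence [minn b N]. *)
move=> bN; suff -> : (\sum_(k < N) (a <= k < b) = minn b N - a)%N by lia.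
elim: N {bN} => [|N IH]; first by rewrite big_ord0; lia.
by rewrite big_ord_recr /= IH; lia.
Qed.

Definition psd_form (C : numClosedFieldType) n (K : 'I_n -> 'I_n -> C) :=
  forall v : 'I_n -> C, 0 <= \sum_i \sum_j (v i)^* * v j * K i j.

Definition gram (C : numClosedFieldType) n (K : 'I_n -> 'I_n -> C) :=
  exists (r : nat) (F : 'I_r -> 'I_n -> C),
    forall i j, K i j = \sum_l (F l i)^* * F l j.

(** Schur product theorem: the form of the product at [v] is the sum over [l] of the form of [L] at
    the entrywise product of [F l] and [v]. *)
Lemma psd_form_mul (C : numClosedFieldType) n (K L : 'I_n -> 'I_n -> C) :
  gram K -> psd_form L -> psd_form (fun i j => K i j * L i j).
Proof.
move=> [r [F KE]] pL v.
have -> : \sum_i \sum_j (v i)^* * v j * (K i j * L i j) =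
    \sum_l \sum_i \sum_j (F l i * v i)^* * (F l j * v j) * L i j.
  rewrite [RHS]exchange_big; apply: eq_bigr => i _.
  rewrite [RHS]exchange_big; apply: eq_bigr => j _.
  rewrite KE mulr_suml mulr_sumr; apply: eq_bigr => l _.
  by rewrite rmorphM /=; ring.
by rewrite sumr_ge0 // => l _; apply: pL.
Qed.

Lemma psd_form_prod (C : numClosedFieldType) n (I : Type) (s : seq I)
    (K : I -> 'I_n -> 'I_n -> C) :
  (forall k, gram (K k)) -> psd_form (fun i j => \prod_(k <- s) K k i j).
Proof.
move=> gK; elim: s => [|k s IH] v.
  (* The empty product is the all-ones kernel, whose form is the squared modulus of the sum of
     [v]. *)
  have -> : \sum_i \sum_j (v i)^* * v j * (\prod_(k <- [::]) K k i j)
      = (\sum_i v i) * (\sum_i v i)^*.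
    rewrite mulrC rmorph_sum mulr_suml; apply: eq_bigr => i _.
    by rewrite mulr_sumr; apply: eq_bigr => j _; rewrite big_nil mulr1.
  exact: mul_conjC_ge0.
have := psd_form_mul (gK k) IH v; congr (_ <= _).
by apply: eq_bigr => i _; apply: eq_bigr => j _; rewrite big_cons.
Qed.

Lemma gram_psdmx (C : numClosedFieldType) d n (A : 'M[C]_d) (f : 'I_n -> 'I_d) :
  psdmx A -> gram (fun i j => A (f i) (f j)).
Proof.
move=> /psd_factor[F ->]; exists d, (fun l i => F l (f i)) => i j.
by rewrite mxE; apply: eq_bigr => l _; rewrite adjmxE.
Qed.

Lemma gram_swap (C : numClosedFieldType) n (K : 'I_n -> 'I_n -> C) :
  gram K -> gram (fun i j => K j i).
Proof.
move=> [r [F KE]]; exists r, (fun l i => (F l i)^*) => i j.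
by rewrite KE; apply: eq_bigr => l _; rewrite conjCK mulrC.
Qed.

(* Swapping [i] and [j] transposes the first [m] qubits: the entries of [rho] at
   [(test_string m d i j, test_string m d j i)] form a principal submatrix of
   the partial transpose. *)
Definition test_string N m d (i j : nat) : bits N :=
  [ffun k : 'I_N => if [|| (k < j)%N, (m <= k < m + i)%N
                         | (m + m <= k < m + m + d)%N] then 0 else 1].

(** The zeros fill [[0, j)], [[m, m + i)] and [[2m, 2m + d)], which are disjoint as [i, j <= m]. *)
Lemma zeros_test_string N m d i j : (m + m + d <= N)%N ->
  (i <= m)%N -> (j <= m)%N ->
  zeros (enum_rank (test_string N m d i j)) = (i + j + d)%N.
Proof.
move=> mN im jm; rewrite /zeros /bits_of enum_rankK -sum1dep_card big_mkcond /=.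
transitivity (\sum_(k < N) ((0 <= k < j) + (m <= k < m + i)
                            + (m + m <= k < m + m + d)))%N.
  apply: eq_bigr => k _; rewrite ffunE.
  have -> (c : bool) : ((if c then 0 else 1 : 'I_2) == 0) = c by case: c.
  by case: ifP => [|/negbT]; lia.
rewrite !big_split !sum_interval /=; lia.
Qed.

Lemma separable_psdker (R : realType) N (chi : nat -> R) m d :
  (m + m + d <= N)%N -> separable (diag_sym N chi) ->
  psdker m.+1 (fun i j => chi (i + j + d)%N).
Proof.
move=> mN [s [p [alpha [p0 _ st rhoE]]]] v.
pose t (i j : 'I_m.+1) := test_string N m d i j.
pose K l (k : 'I_N) (i j : 'I_m.+1) := alpha l k (t i j k) (t j i k).
have chiE (i j : 'I_m.+1) :
    (chi (i + j + d)%N)%:C%C = \sum_l (p l)%:C%C * \prod_k K l k i j.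
  have im : (i <= m)%N by rewrite -ltnS.
  have jm : (j <= m)%N by rewrite -ltnS.
  (* Both strings have [i + j + d] zeros, so this entry of the state is [chi (i + j + d)]. *)
  have := congr1 (fun M : 'M_(dimq N) =>
            M (enum_rank (t i j)) (enum_rank (t j i))) rhoE.
  rewrite diag_symE !zeros_test_string // [(j + i)%N]addnC eqxx mulr1n => ->.
  rewrite summxE; apply: eq_bigr => l _; rewrite !mxE; congr (_ * _).
  by apply: eq_bigr => k _; rewrite /bits_of !enum_rankK.
(* On a qubit [k < m] the string [t i j] depends on [j] alone, so the factor appears transposed; on
   the other qubits it depends at most on [i]. *)
have gK l k : gram (K l k).
  have [pA _] := st l k.
  have [km|mk] := ltnP k m.
    have [r [F FE]] := gram_swap (gram_psdmx (fun i : 'I_m.+1 => t ord0 i k) pA).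
    exists r, F => i j; rewrite -FE /K; congr (alpha l k _ _);
      rewrite !ffunE; congr (if _ then _ else _); lia.
  have [r [F FE]] := gram_psdmx (fun i : 'I_m.+1 => t i ord0 k) pA.
  exists r, F => i j; rewrite -FE /K; congr (alpha l k _ _);
    rewrite !ffunE /=; congr (if _ then _ else _).
    by have := ltn_ord j; lia.
  by have := ltn_ord i; lia.
rewrite -ler0c.
have -> : (kform m.+1 (fun i j => chi (i + j + d)%N) v)%:C%C = \sum_l (p l)%:C%C *
    \sum_(i < m.+1) \sum_(j < m.+1) ((v i)%:C%C)^* * (v j)%:C%C * \prod_k K l k i j.
  under [RHS]eq_bigr do rewrite mulr_sumr.
  rewrite [RHS]exchange_big /= rmorph_sum; apply: eq_bigr => i _.
  under [RHS]eq_bigr do rewrite mulr_sumr.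
  rewrite [RHS]exchange_big /= rmorph_sum; apply: eq_bigr => j _.
  have -> : ((v i)%:C%C)^* = (v i)%:C%C :> R[i].
    by apply/CrealP; rewrite complex_real.
  rewrite !rmorphM /= chiE mulr_sumr; apply: eq_bigr => l _.
  by rewrite mulrCA.
rewrite sumr_ge0 // => l _; rewrite mulr_ge0 ?ler0c //.
exact: (psd_form_prod (index_enum 'I_N) (gK l) (fun i => (v i)%:C%C)).
Qed.

End PartialTranspose.

(** * Separability in terms of the two Hankel matrices *)

Lemma real_psdmxP (R : realType) n (K : nat -> nat -> R) :
  (forall i j, K i j = K j i) ->
  real_psdmx (\matrix_(i < n, j < n) K i j) <-> psdker n K.
Proof.
move=> symK.
have formE (v : 'cV[R]_n) (f : nat -> R) : (forall i : 'I_n, f i = v i 0) ->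
    (v^T *m \matrix_(i < n, j < n) K i j *m v) 0 0 = kform n K f.
  move=> fv; rewrite mxE [kform _ _ _]exchange_big; apply: eq_bigr => j _.
  rewrite mxE mulr_suml; apply: eq_bigr => i _.
  by rewrite !mxE !fv; ring.
split=> [[_ pM] f|pK].
  by rewrite -(formE (\col_i f i)) => [|i]; [exact: pM|rewrite mxE].
split=> [|v]; first by apply/matrixP => i j; rewrite !mxE symK.
rewrite (formE v (fun i => oapp (fun k => v k 0) 0 (insub i))) // => i.
by rewrite valK.
Qed.

Theorem theorem1 (R : realType) (N : nat) (hN : (1 <= N)%N) (chi : nat -> R)
    (hrho : is_state (diag_sym N chi)) :
  separable (diag_sym N chi) <->
  real_psdmx (hankel0 N chi) /\ real_psdmx (hankel1 N chi).
Proof.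
have sym0 i j : chi (i + j)%N = chi (j + i)%N by rewrite addnC.
have sym1 i j : chi (i + j).+1 = chi (j + i).+1 by rewrite addnC.
rewrite (real_psdmxP N./2.+1 sym0) (real_psdmxP N.+1./2 sym1).
split=> [sep|[p0 p1]]; last first.
  by apply: atomic_separable; [case: hrho | apply: hankel_atomic].
split.
  apply: (eq_psdker (K := fun i j => chi (i + j + 0)%N)) => [i j _ _|].
    by rewrite addn0.
  by apply: separable_psdker sep; rewrite addn0 addnn -[leqRHS]odd_double_half leq_addl.
(* For [N = n + 1] the second matrix has size [n./2.+1]; take [m = n./2] and [d = 1], so that
   [2m + 1 <= N]. *)
case: N hN sep {hrho} => [//|n] _ sep.
apply: (eq_psdker (K := fun i j => chi (i + j + 1)%N)) => [i j _ _|].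
  by rewrite addn1.
apply: separable_psdker sep.
by rewrite addn1 ltnS addnn -[leqRHS]odd_double_half leq_addl.
Qed.
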